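(* Let $F$ be a field of characteristic zero, let $r_1,\dots,r_n\in F^*$ with $\sum_{i=1}^n r_i=k$, where $k\in\mathbb N$, and let $\vec\lambda=(-r_1,\dots,-r_n,1)$. Then the algebra $A(n)$ is Morita equivalent to the deformed preprojective algebra $\Pi_{\vec\lambda}({\cal Q})$ of the star quiver ${\cal Q}$.
   Context: $A(n)$ is the unital associative $F$-algebra with generators $P,q_1,\dots,q_n$ and relations $P^2=P$, $q_i^2=q_i$, $q_iq_j=0$ for $i\neq j$, $q_iPq_i=r_iq_i$ for $i=1,\dots,n$, and $\sum_{i=1}^nq_i=1$. Deformed preprojective algebra: for a quiver $Q$ without loops, with vertex set $Q_0$ and arrow set $Q_1$, let $Q^d$ be the double quiver, obtained by adding to each arrow $a\in Q_1$ an opposite arrow $a^*$. Let $c=\sum_{a\in Q_1}[a,a^*]\in FQ^d$, where $FQ^d$ is the path algebra, and for $\vec\lambda=(\lambda_1,\dots,\lambda_m)\in F^m$, $m=|Q_0|$, put $\Pi_{\vec\lambda}(Q)=FQ^d/\langle c-\sum_{i=1}^m\lambda_ie_i\rangle$, where $e_i$ is the idempotent (constant path) at vertex $i$. The star quiver ${\cal Q}$ has one central vertex and $n$ boundary vertices, with exactly one arrow from the central vertex to each boundary vertex. In $\vec\lambda$, the entries $-r_1,\dots,-r_n$ correspond to the boundary vertices and the entry $1$ corresponds to the central vertex. *)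

(* Defs.v *)
From HB Require Import structures.
From mathcomp Require Import all_boot all_algebra.
From mathcomp Require Import finmap boolp.
From mathcomp.multinomials Require Import monalg.

Set Implicit Arguments.
Unset Strict Implicit.
Unset Printing Implicit Defensive.

Import GRing.Theory.
Local Open Scope ring_scope.
Local Open Scope quotient_scope.

(* A unital associative [F]-algebra is a ring with a central ring morphism from
   [F].  The zero algebra is allowed, unlike in MathComp's [algType F], since an
   algebra given by generators and relations may vanish. *)
Record falgebra (F : pzRingType) := FAlgebra {
  alg_ring :> pzRingType;
  alg_scal : {rmorphism F -> alg_ring};
  alg_scalC : forall (c : F) (x : alg_ring), alg_scal c * x = x * alg_scal c
}.

Section QuotientRing.

Definition two_sided_ideal (R : pzRingType) (I : R -> Prop) : Prop :=
  [/\ I 0, forall x y, I x -> I y -> I (x - y)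
    & forall a x, I x -> I (a * x) /\ I (x * a)].

Definition ideal_gen (R : pzRingType) (S : R -> Prop) (x : R) : Prop :=
  forall I : R -> Prop,
    two_sided_ideal I -> (forall s, S s -> I s) -> I x.

Lemma ideal_genP (R : pzRingType) (S : R -> Prop) :
  two_sided_ideal (ideal_gen S).
Proof.
split=> [I [] //|x y Ix Iy I idI SI|a x Ix].
  by case: (idI) => _ + _; apply; [exact: Ix | exact: Iy].
by split=> I idI SI; case: (idI) => _ _ /(_ a x (Ix I idI SI)) [].
Qed.

Lemma ideal_genN (R : pzRingType) (S : R -> Prop) x :
  ideal_gen S x -> ideal_gen S (- x).
Proof.
by case: (ideal_genP S) => I0 IB _ /(IB 0 x I0); rewrite sub0r.
Qed.

Lemma ideal_genD (R : pzRingType) (S : R -> Prop) x y :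
  ideal_gen S x -> ideal_gen S y -> ideal_gen S (x + y).
Proof.
move=> Ix /ideal_genN Iy; case: (ideal_genP S) => _ IB _.
by have := IB _ _ Ix Iy; rewrite opprK.
Qed.

Variables (R : pzRingType) (S : R -> Prop).

Definition ideal_rel : rel R := fun x y => `[< ideal_gen S (x - y) >].

Lemma ideal_rel_equiv : equiv_class_of ideal_rel.
Proof.
split=> [x|x y|y x z].
- by apply/asboolP; rewrite subrr; case: (ideal_genP S).
- by apply/asboolP/asboolP => /ideal_genN; rewrite opprB.
- move=> /asboolP xy /asboolP yz; apply/asboolP.
  by have := ideal_genD xy yz; rewrite addrA subrK.
Qed.

Canonical ideal_rel_equiv_rel := EquivRelPack ideal_rel_equiv.

(* The quotient of [R] by the two-sided ideal generated by [S]. *)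
Definition quot_ring := {eq_quot ideal_rel}.

Local Notation QR := quot_ring.
HB.instance Definition _ := Choice.on quot_ring.
HB.instance Definition _ := EqQuotient.on quot_ring.

Lemma quot_ringW (P : quot_ring -> Prop) :
  (forall x : R, P (\pi_QR x)) -> forall y, P y.
Proof. by move=> Px y; rewrite -[y]reprK. Qed.

Lemma quot_ringP (x y : R) :
  reflect (ideal_gen S (x - y)) (x == y %[mod quot_ring]).
Proof. by rewrite -[_ == _]/(_ == _) eqmodE; apply: asboolP. Qed.

Lemma quot_ring_eq (x y : R) : ideal_gen S (x - y) -> \pi_QR x = \pi_QR y.
Proof. by move=> Ixy; apply/eqP/quot_ringP. Qed.

Lemma quot_ring_repr (x : R) : ideal_gen S (repr (\pi_QR x) - x).
Proof. by apply/quot_ringP; rewrite reprK. Qed.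

Definition qzero : quot_ring := \pi_QR 0.
Definition qone : quot_ring := \pi_QR 1.
Definition qopp (x : quot_ring) : quot_ring := \pi_QR (- repr x).
Definition qadd (x y : quot_ring) : quot_ring := \pi_QR (repr x + repr y).
Definition qmul (x y : quot_ring) : quot_ring := \pi_QR (repr x * repr y).

Lemma pi_qopp (x : R) : qopp (\pi_QR x) = \pi_QR (- x).
Proof.
by apply: quot_ring_eq; rewrite -opprD; exact: ideal_genN (quot_ring_repr x).
Qed.

Lemma pi_qadd (x y : R) : qadd (\pi_QR x) (\pi_QR y) = \pi_QR (x + y).
Proof.
apply: quot_ring_eq; rewrite opprD addrACA.
by apply: ideal_genD; apply: quot_ring_repr.
Qed.

Lemma pi_qmul (x y : R) : qmul (\pi_QR x) (\pi_QR y) = \pi_QR (x * y).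
Proof.
apply: quot_ring_eq; set x' := repr _; set y' := repr _.
have -> : x' * y' - x * y = x' * (y' - y) + (x' - x) * y.
  by rewrite mulrBr mulrBl addrA subrK.
have [_ _ IM] := ideal_genP S.
apply: ideal_genD; first exact: (IM x' _ (quot_ring_repr y)).1.
exact: (IM y _ (quot_ring_repr x)).2.
Qed.

Let piqE := (pi_qopp, pi_qadd, pi_qmul).

Fact qaddA : associative qadd.
Proof. by elim/quot_ringW=> x; elim/quot_ringW=> y; elim/quot_ringW=> z; rewrite !piqE addrA. Qed.
Fact qaddC : commutative qadd.
Proof. by elim/quot_ringW=> x; elim/quot_ringW=> y; rewrite !piqE addrC. Qed.
Fact qadd0 : left_id qzero qadd.
Proof. by elim/quot_ringW=> x; rewrite /qzero !piqE add0r. Qed.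
Fact qaddN : left_inverse qzero qopp qadd.
Proof. by elim/quot_ringW=> x; rewrite !piqE addNr. Qed.
HB.instance Definition _ := GRing.isZmodule.Build quot_ring
  qaddA qaddC qadd0 qaddN.

Fact qmulA : associative qmul.
Proof. by elim/quot_ringW=> x; elim/quot_ringW=> y; elim/quot_ringW=> z; rewrite !piqE mulrA. Qed.
Fact qmul1 : left_id qone qmul.
Proof. by elim/quot_ringW=> x; rewrite /qone !piqE mul1r. Qed.
Fact qmulr1 : right_id qone qmul.
Proof. by elim/quot_ringW=> x; rewrite /qone !piqE mulr1. Qed.
Fact qmulDl : left_distributive qmul qadd.
Proof. by elim/quot_ringW=> x; elim/quot_ringW=> y; elim/quot_ringW=> z; rewrite !piqE mulrDl. Qed.
Fact qmulDr : right_distributive qmul qadd.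
Proof. by elim/quot_ringW=> x; elim/quot_ringW=> y; elim/quot_ringW=> z; rewrite !piqE mulrDr. Qed.
HB.instance Definition _ := GRing.Zmodule_isPzRing.Build quot_ring
  qmulA qmul1 qmulr1 qmulDl qmulDr.

End QuotientRing.

Section QuotientAlgebra.
Variables (F : pzRingType) (A : falgebra F) (S : A -> Prop).

Definition quot_scal (c : F) : quot_ring S := \pi_(quot_ring S) (alg_scal A c).

Fact quot_scal_zmod : zmod_morphism quot_scal.
Proof. by move=> c d; rewrite /quot_scal rmorphB -pi_qadd -pi_qopp. Qed.

Fact quot_scal_monoid : monoid_morphism quot_scal.
Proof.
by split=> [|c d]; rewrite /quot_scal (rmorph1, rmorphM) -?pi_qmul.
Qed.

HB.instance Definition _ := GRing.isZmodMorphism.Build F (quot_ring S)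
  quot_scal quot_scal_zmod.
HB.instance Definition _ := GRing.isMonoidMorphism.Build F (quot_ring S)
  quot_scal quot_scal_monoid.

Fact quot_scalC (c : F) (x : quot_ring S) : quot_scal c * x = x * quot_scal c.
Proof.
by elim/quot_ringW: x => x; rewrite /GRing.mul /= !pi_qmul alg_scalC.
Qed.

Definition quot_alg : falgebra F := FAlgebra quot_scalC.

End QuotientAlgebra.

Section FreeAlgebra.
Variables (F : fieldType) (X : choiceType).

Fact free_scalC (c : F) (x : {malg F[{fmonom X}]}) : c%:MP * x = x * c%:MP.
Proof.
rewrite mul_malgC malgZ_def malgM_def fgmulgU.
by apply: eq_bigr => k _; rewrite mulm1 mulrC.
Qed.

Definition free_alg : falgebra F :=
  @FAlgebra F {malg F[{fmonom X}]} (@malgC {fmonom X} F) free_scalC.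

Definition free_gen (x : X) : free_alg := << fmu x >>.

End FreeAlgebra.

Record quiver := Quiver {
  vertex : finType;
  arrow : finType;
  src : arrow -> vertex;
  tgt : arrow -> vertex
}.

Section Paths.
Variable Q : quiver.

Fixpoint is_path (v : vertex Q) (s : seq (arrow Q)) : bool :=
  if s is a :: s' then (src a == v) && is_path (tgt a) s' else true.

Definition endpoint (v : vertex Q) (s : seq (arrow Q)) : vertex Q :=
  last v (map (@tgt Q) s).

Lemma is_path_cat v s t :
  is_path v (s ++ t) = is_path v s && is_path (endpoint v s) t.
Proof. by elim: s v => //= a s IHs v; rewrite IHs andbA. Qed.

Lemma endpoint_cat v s t : endpoint v (s ++ t) = endpoint (endpoint v s) t.
Proof. by rewrite /endpoint map_cat last_cat. Qed.

(* A path is its source together with its list of successive arrows. *)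
Definition qpath := {p : vertex Q * seq (arrow Q) | is_path p.1 p.2}.
HB.instance Definition _ := Choice.on qpath.
HB.instance Definition _ := SubType.on qpath.

Definition path_src (p : qpath) : vertex Q := (val p).1.
Definition path_tgt (p : qpath) : vertex Q := endpoint (val p).1 (val p).2.

Definition vertex_path (v : vertex Q) : qpath :=
  exist (fun p => is_path p.1 p.2) (v, [::]) isT.

Fact arrow_path_proof (a : arrow Q) : is_path (src a) [:: a].
Proof. by rewrite /= eqxx. Qed.
Definition arrow_path (a : arrow Q) : qpath :=
  exist (fun p => is_path p.1 p.2) (src a, [:: a]) (arrow_path_proof a).

Fact path_cat_proof (p q : qpath) : path_tgt p = path_src q ->
  is_path (path_src p) ((val p).2 ++ (val q).2).
Proof.
by move=> pq; rewrite is_path_cat (valP p) -/(path_tgt p) pq; apply: (valP q).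
Qed.
Definition path_cat (p q : qpath) (pq : path_tgt p = path_src q) : qpath :=
  exist (fun p => is_path p.1 p.2) (path_src p, (val p).2 ++ (val q).2)
    (path_cat_proof pq).

Lemma path_cat_tgt p q (pq : path_tgt p = path_src q) :
  path_tgt (path_cat pq) = path_tgt q.
Proof. by rewrite /path_tgt /= endpoint_cat -/(path_tgt p) pq. Qed.

End Paths.

Lemma bilinear_assoc (R : comNzRingType) (V : lmodType R) (I : Type)
    (e : I -> V) (m : V -> V -> V) :
  (forall P : V -> Prop, P 0 -> (forall x y, P x -> P y -> P (x + y)) ->
     (forall c i, P (c *: e i)) -> forall x, P x) ->
  left_distributive m +%R -> right_distributive m +%R ->
  (forall c x y, m (c *: x) y = c *: m x y) ->
  (forall c x y, m x (c *: y) = c *: m x y) ->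
  (forall i j k, m (e i) (m (e j) (e k)) = m (m (e i) (e j)) (e k)) ->
  associative m.
Proof.
move=> ind Dl Dr Zl Zr A.
have m0l x : m 0 x = 0 by rewrite -[0](scale0r 0) Zl !scale0r.
have m0r x : m x 0 = 0 by rewrite -[0](scale0r 0) Zr !scale0r.
move=> x y z; elim/ind: x => [|x x' IHx IHx'|c i].
- by rewrite !m0l.
- by rewrite !Dl IHx IHx'.
rewrite !Zl; congr (_ *: _); elim/ind: y => [|y y' IHy IHy'|d j].
- by rewrite !(m0l, m0r).
- by rewrite !(Dl, Dr) IHy IHy'.
rewrite !(Zl, Zr); congr (_ *: _); elim/ind: z => [|z z' IHz IHz'|f k].
- by rewrite !m0r.
- by rewrite !Dr IHz IHz'.
by rewrite !Zr A.
Qed.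

Section PathAlgebra.
Variables (F : fieldType) (Q : quiver).

(* The path algebra: formal linear combinations of paths. *)
Definition path_ring := {malg F[qpath Q]}.
HB.instance Definition _ := GRing.Lmodule.on path_ring.

Definition path_elt (p : qpath Q) : path_ring := << p >>.

(* Paths are composed from left to right: [p] comes first in [p * q]. *)
Definition path_mul (p q : qpath Q) : path_ring :=
  if path_tgt p =P path_src q is ReflectT pq then path_elt (path_cat pq) else 0.

Lemma path_combE (x : path_ring) :
  x = \sum_(p <- msupp x) x@_p *: path_elt p.
Proof.
rewrite [LHS]monalgE; apply: eq_bigr => p _.
apply/malgP => q; rewrite mcoeffZ.
by rewrite /path_elt [in RHS]mcoeffU (mcoeffU p (x@_p)) mulr_natr.
Qed.

Lemma path_ring_ind (P : path_ring -> Prop) :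
  P 0 -> (forall x y, P x -> P y -> P (x + y)) ->
  (forall (c : F) (p : qpath Q), P (c *: path_elt p)) -> forall x, P x.
Proof. by move=> P0 PD PZ x; rewrite [x]path_combE; apply: big_ind. Qed.

Definition pone : path_ring := \sum_(v : vertex Q) path_elt (vertex_path v).
Definition pmul (x y : path_ring) : path_ring :=
  \sum_(p <- msupp x) \sum_(q <- msupp y) (x@_p * y@_q) *: path_mul p q.

Lemma pmulEw (d1 d2 : {fset qpath Q}) (x y : path_ring) :
  (msupp x `<=` d1)%fset -> (msupp y `<=` d2)%fset ->
  pmul x y = \sum_(p <- d1) \sum_(q <- d2) (x@_p * y@_q) *: path_mul p q.
Proof.
move=> le1 le2; rewrite /pmul (big_fset_incl _ le1) /=.
  apply/eq_bigr=> p _; apply/big_fset_incl => // q _ /mcoeff_outdom ->.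
  by rewrite mulr0 scale0r.
move=> p _ /mcoeff_outdom xp.
by rewrite big1 // => q _; rewrite xp mul0r scale0r.
Qed.

Fact pmulDl : left_distributive pmul +%R.
Proof.
move=> x y z.
rewrite [in RHS](pmulEw (fsubsetUl _ (msupp y)) (fsubset_refl _)).
rewrite [in RHS](pmulEw (fsubsetUr (msupp x) _) (fsubset_refl _)).
rewrite (pmulEw (msuppD_le _ _) (fsubset_refl _)).
rewrite -big_split /=; apply/eq_bigr=> p _.
rewrite -big_split /=; apply/eq_bigr=> q _.
by rewrite mcoeffD mulrDl scalerDl.
Qed.

Fact pmulDr : right_distributive pmul +%R.
Proof.
move=> z x y.
rewrite [in RHS](pmulEw (fsubset_refl _) (fsubsetUl _ (msupp y))).
rewrite [in RHS](pmulEw (fsubset_refl _) (fsubsetUr (msupp x) _)).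
rewrite (pmulEw (fsubset_refl _) (msuppD_le _ _)).
rewrite -big_split /=; apply/eq_bigr=> p _.
rewrite -big_split /=; apply/eq_bigr=> q _.
by rewrite mcoeffD mulrDr scalerDl.
Qed.

Lemma pmul0l x : pmul 0 x = 0.
Proof. by rewrite /pmul msupp0 big_seq_fset0. Qed.
Lemma pmul0r x : pmul x 0 = 0.
Proof. by rewrite /pmul big1 // => p _; rewrite msupp0 big_seq_fset0. Qed.

Lemma pmulZl c x y : pmul (c *: x) y = c *: pmul x y.
Proof.
rewrite (pmulEw (msuppZ_le _ _) (fsubset_refl _)) /pmul scaler_sumr.
apply/eq_bigr=> p _; rewrite scaler_sumr; apply/eq_bigr=> q _.
by rewrite mcoeffZ scalerA mulrA.
Qed.

Lemma pmulZr c x y : pmul x (c *: y) = c *: pmul x y.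
Proof.
rewrite (pmulEw (fsubset_refl _) (msuppZ_le _ _)) /pmul scaler_sumr.
apply/eq_bigr=> p _; rewrite scaler_sumr; apply/eq_bigr=> q _.
by rewrite mcoeffZ scalerA mulrCA.
Qed.

Lemma pmulUU (p q : qpath Q) : pmul (path_elt p) (path_elt q) = path_mul p q.
Proof.
rewrite (pmulEw msuppU_le msuppU_le) !big_seq_fset1 !mcoeffUU.
by rewrite mulr1 scale1r.
Qed.

Lemma pmul_suml (I : Type) (r : seq I) (P : pred I) (f : I -> path_ring) x :
  pmul (\sum_(i <- r | P i) f i) x = \sum_(i <- r | P i) pmul (f i) x.
Proof. exact: (big_morph (pmul^~ x) (fun _ _ => pmulDl _ _ _) (pmul0l x)). Qed.

Lemma pmul_sumr (I : Type) (r : seq I) (P : pred I) (f : I -> path_ring) x :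
  pmul x (\sum_(i <- r | P i) f i) = \sum_(i <- r | P i) pmul x (f i).
Proof. exact: (big_morph (pmul x) (fun _ _ => pmulDr _ _ _) (pmul0r x)). Qed.

Lemma path_mulT p q (pq : path_tgt p = path_src q) :
  path_mul p q = path_elt (path_cat pq).
Proof.
rewrite /path_mul; case: eqP => [e|/(_ pq) []].
by rewrite (eq_irrelevance e pq).
Qed.

Lemma path_mulF p q : path_tgt p <> path_src q -> path_mul p q = 0.
Proof. by rewrite /path_mul; case: eqP. Qed.

Lemma path_mulA (p q r : qpath Q) :
  pmul (path_elt p) (path_mul q r) = pmul (path_mul p q) (path_elt r).
Proof.
have [qr|qr] := eqVneq (path_tgt q) (path_src r); last first.
  rewrite (path_mulF (elimN eqP qr)) pmul0r.
  have [pq|/eqP pq] := eqVneq (path_tgt p) (path_src q).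
    rewrite (path_mulT pq) pmulUU path_mulF // path_cat_tgt; exact/eqP.
  by rewrite (path_mulF pq) pmul0l.
rewrite (path_mulT qr) pmulUU.
have [pq|/eqP pq] := eqVneq (path_tgt p) (path_src q); last first.
  by rewrite (path_mulF pq) pmul0l path_mulF.
have pqr : path_tgt p = path_src (path_cat qr) by [].
have pqr' : path_tgt (path_cat pq) = path_src r by rewrite path_cat_tgt.
rewrite (path_mulT pq) pmulUU (path_mulT pqr) (path_mulT pqr').
by rewrite (_ : path_cat pqr = path_cat pqr') //; apply: val_inj; rewrite /= catA.
Qed.

Fact pmulA : associative pmul.
Proof.
have A p q r : pmul (path_elt p) (pmul (path_elt q) (path_elt r)) =
               pmul (pmul (path_elt p) (path_elt q)) (path_elt r).
  apply: (etrans (congr1 (pmul _) (pmulUU q r))).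
  exact: (etrans (path_mulA p q r) (congr1 (pmul^~ _) (esym (pmulUU p q)))).
exact: (bilinear_assoc path_ring_ind pmulDl pmulDr pmulZl pmulZr A).
Qed.

Fact pmul1 : left_id pone pmul.
Proof.
move=> x; rewrite [x in pmul _ x]path_combE pmul_sumr [RHS]path_combE.
apply: eq_bigr => p _; rewrite pmulZr pmul_suml; congr (_ *: _).
have e : path_tgt (vertex_path (path_src p)) = path_src p by [].
rewrite (bigD1 (path_src p)) //= big1 => [|v vp]; last first.
  by rewrite pmulUU path_mulF // => e'; case/eqP: vp.
rewrite addr0 pmulUU (path_mulT e) (_ : path_cat e = p) //.
apply: val_inj => /=.
exact: esym (surjective_pairing (val p)).
Qed.

Fact pmulr1 : right_id pone pmul.
Proof.
move=> x; rewrite [x in pmul x _]path_combE pmul_suml [RHS]path_combE.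
apply: eq_bigr => p _; rewrite pmulZl pmul_sumr; congr (_ *: _).
have e : path_tgt p = path_src (vertex_path (path_tgt p)) by [].
rewrite (bigD1 (path_tgt p)) //= big1 => [|v vp]; last first.
  by rewrite pmulUU path_mulF // => e'; case/eqP: vp.
rewrite addr0 pmulUU (path_mulT e) (_ : path_cat e = p) //.
apply: val_inj => /=.
by rewrite cats0; exact: esym (surjective_pairing (val p)).
Qed.

HB.instance Definition _ := GRing.Zmodule_isPzRing.Build path_ring
  pmulA pmul1 pmulr1 pmulDl pmulDr.

Definition path_scal (c : F) : path_ring := c *: (1 : path_ring).

Fact path_scal_zmod : zmod_morphism path_scal.
Proof. by move=> c d; rewrite /path_scal scalerBl. Qed.
Fact path_scal_monoid : monoid_morphism path_scal.
Proof.
split=> [|c d]; rewrite /path_scal ?scale1r //.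
apply: esym; apply: etrans (pmulZl c pone (d *: pone)) _.
exact: etrans (congr1 ( *:%R c) (pmul1 _)) (scalerA c d pone).
Qed.
HB.instance Definition _ := GRing.isZmodMorphism.Build F path_ring
  path_scal path_scal_zmod.
HB.instance Definition _ := GRing.isMonoidMorphism.Build F path_ring
  path_scal path_scal_monoid.

Fact path_scalC (c : F) (x : path_ring) : path_scal c * x = x * path_scal c.
Proof.
apply: etrans (pmulZl c pone x) _.
apply: etrans (congr1 ( *:%R c) _) (esym (pmulZr c x pone)).
exact: etrans (pmul1 x) (esym (pmulr1 x)).
Qed.

Definition path_alg : falgebra F := FAlgebra path_scalC.

Definition pvertex (v : vertex Q) : path_alg := path_elt (vertex_path v).
Definition parrow (a : arrow Q) : path_alg := path_elt (arrow_path a).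

End PathAlgebra.

(* [inl a] is the arrow [a], [inr a] is the opposite arrow [a^*]. *)
Definition double_quiver (Q : quiver) : quiver :=
  @Quiver (vertex Q) (arrow Q + arrow Q)%type
    (fun b => match b with inl a => src a | inr a => tgt a end)
    (fun b => match b with inl a => tgt a | inr a => src a end).

Section DeformedPreprojective.
Variables (F : fieldType) (Q : quiver) (lambda : vertex Q -> F).

Let FQd : falgebra F := path_alg F (double_quiver Q).
Let a_ (a : arrow Q) : FQd := @parrow F (double_quiver Q) (inl a).
Let a_star (a : arrow Q) : FQd := @parrow F (double_quiver Q) (inr a).
Let e_ (v : vertex Q) : FQd := @pvertex F (double_quiver Q) v.

Definition preproj_c : FQd :=
  \sum_(a : arrow Q) (a_ a * a_star a - a_star a * a_ a).

Definition preproj_relation (x : FQd) : Prop :=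
  x = preproj_c - \sum_(v : vertex Q) alg_scal FQd (lambda v) * e_ v.

Definition deformed_preprojective : falgebra F := quot_alg preproj_relation.

End DeformedPreprojective.

(* The vertex [None] is the center, [Some i] is the i-th boundary vertex. *)
Definition star_quiver (n : nat) : quiver :=
  @Quiver (option 'I_n) 'I_n (fun _ => None) (fun i => Some i).

Definition star_weight (F : fieldType) (n : nat) (r : 'I_n -> F) :
    vertex (star_quiver n) -> F :=
  fun v => if v is Some i then - r i else 1.

Section AlgebraA.
Variables (F : fieldType) (n : nat) (r : 'I_n -> F).

Let Fr : falgebra F := free_alg F (option 'I_n).
Let P : Fr := free_gen F None.
Let q (i : 'I_n) : Fr := free_gen F (Some i).

(* [A_relation x] states that [x = 0] is one of the defining relations. *)
Inductive A_relation : Fr -> Prop :=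
| A_rel_P : A_relation (P ^+ 2 - P)
| A_rel_q i : A_relation (q i ^+ 2 - q i)
| A_rel_qq i j : i != j -> A_relation (q i * q j)
| A_rel_qPq i : A_relation (q i * P * q i - alg_scal Fr (r i) * q i)
| A_rel_sum : A_relation (\sum_(i < n) q i - 1).

Definition A_alg : falgebra F := quot_alg A_relation.

End AlgebraA.

(* [F]-linear functors between categories of left modules.  An [A]-module [M]
   is an [F]-vector space through [alg_scal A], and linearity of the action on
   morphisms is stated pointwise: [h = c f + g] implies [T h = c (T f) + T g]. *)
Record lin_functor (F : pzRingType) (A B : falgebra F) := LinFunctor {
  fobj :> lmodType A -> lmodType B;
  fmor : forall M N : lmodType A, {linear M -> N} -> {linear fobj M -> fobj N};
  fmor_id : forall (M : lmodType A), fmor (idfun : {linear M -> M}) =1 id;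
  fmor_comp : forall (M N K : lmodType A)
    (g : {linear N -> K}) (f : {linear M -> N}),
    fmor (g \o f : {linear M -> K}) =1 fmor g \o fmor f;
  fmor_linear : forall (M N : lmodType A) (c : F) (f g h : {linear M -> N}),
    (forall x, h x = alg_scal A c *: f x + g x) ->
    forall y, fmor h y = alg_scal B c *: fmor f y + fmor g y
}.

(* [S o T] is naturally isomorphic to the identity functor. *)
Definition comp_iso_id (F : pzRingType) (A B : falgebra F)
    (S : lin_functor B A) (T : lin_functor A B) : Prop :=
  exists eta : forall M : lmodType A, {linear M -> S (T M)},
    (forall M, bijective (eta M)) /\
    (forall (M N : lmodType A) (f : {linear M -> N}) (x : M),
       eta N (f x) = fmor S (fmor T f) (eta M x)).

Definition morita_equivalent (F : pzRingType) (A B : falgebra F) : Prop :=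
  exists (T : lin_functor A B) (S : lin_functor B A),
    comp_iso_id S T /\ comp_iso_id T S.

(* Main.v *)
From HB Require Import structures.
Require Import Defs.
From mathcomp Require Import all_boot all_algebra.
From mathcomp Require Import finmap.
From mathcomp.multinomials Require Import monalg.

(* Let [e] be the sum of the boundary idempotents of [Pi], [X] the sum of the
   arrows [a_i] and [Y] the sum of the [a_i^*].  The preprojective relation says
   that [X Y = e_0] and [a_i^* a_i = r_i e_i], so [q_i |-> e_i], [P |-> Y X]
   defines a map [phi] from [A(n)] to the corner [e Pi e], and conversely
   [e_0 |-> P E_11], [e_i |-> q_i E_00], [a_i |-> P q_i E_10],
   [a_i^* |-> q_i P E_01] defines a map [psi] from [Pi] to the corner of
   [M_2(A(n))] cut out by [diag(1, P)].  The corresponding functors are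
   [N |-> e N] and [M |-> M + P M].  They are inverse to each other because
   [psi (phi a) = a E_00] and [phi (psi z) = w z w'] with [w] the column
   [(e, Y)] and [w'] the row [(e, X)], for which [w' w = e + X Y = 1]. *)

Set Implicit Arguments.
Unset Strict Implicit.
Unset Printing Implicit Defensive.

Import GRing.Theory.
Local Open Scope ring_scope.

(** * Functors induced by non-unital morphisms *)

(* Not required to preserve 1: a morphism onto a corner [e B e]. *)
Record corner_hom (F : pzRingType) (A B : falgebra F) := CornerHom {
  corner_fun :> A -> B;
  corner_homB : zmod_morphism corner_fun;
  corner_homM : {morph corner_fun : x y / x * y};
  corner_homZ : forall c x,
    corner_fun (alg_scal A c * x) = alg_scal B c * corner_fun x
}.

HB.instance Definition _ F (A B : falgebra F) (f : corner_hom A B) :=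
  GRing.isZmodMorphism.Build A B f (corner_homB f).

Lemma scalar_mx_scalC (F : pzRingType) (A : falgebra F) m (c : F)
    (X : 'M[A]_m) : (alg_scal A c)%:M * X = X * (alg_scal A c)%:M.
Proof.
rewrite [LHS]mul_scalar_mx; apply/matrixP=> i j.
rewrite !mxE (bigD1 j) //= big1 ?addr0 ?mxE ?eqxx ?mulr1n ?alg_scalC //.
by move=> k /negPf kj; rewrite !mxE kj mulr0.
Qed.

Definition mx_alg (F : pzRingType) (A : falgebra F) (m : nat) : falgebra F :=
  @FAlgebra F 'M[A]_m (@scalar_mx A m \o alg_scal A) (@scalar_mx_scalC F A m).

(** * Matrices acting on columns of module elements *)

Section MatrixAction.
Variables (R : pzRingType) (m : nat).

Definition mx_act (M : lmodType R) (X : 'M[R]_m) (u : {ffun 'I_m -> M}) :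
  {ffun 'I_m -> M} := [ffun i => \sum_j X i j *: u j].

Section Theory.
Variable M : lmodType R.
Implicit Types (X Y : 'M[R]_m) (u v : {ffun 'I_m -> M}).

Lemma mx_actM X Y u : mx_act X (mx_act Y u) = mx_act (X * Y) u.
Proof.
apply/ffunP=> i; rewrite !ffunE.
under eq_bigr => j _ do rewrite ffunE scaler_sumr.
rewrite exchange_big; apply: eq_bigr => k _ /=.
by rewrite mxE scaler_suml; apply: eq_bigr => j _; rewrite scalerA.
Qed.

Lemma mx_actDl X Y u : mx_act (X + Y) u = mx_act X u + mx_act Y u.
Proof.
apply/ffunP=> i; rewrite !ffunE -big_split /=.
by apply: eq_bigr => j _; rewrite mxE scalerDl.
Qed.

Fact mx_act_zmod X : zmod_morphism (@mx_act M X).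
Proof.
move=> u v; apply/ffunP=> i; rewrite !ffunE -sumrB.
by apply: eq_bigr => j _; rewrite !ffunE scalerBr.
Qed.

HB.instance Definition _ X := GRing.isZmodMorphism.Build
  {ffun 'I_m -> M} {ffun 'I_m -> M} (@mx_act M X) (mx_act_zmod X).

Lemma mx_act_scalar a u : mx_act a%:M u = [ffun i => a *: u i].
Proof.
apply/ffunP=> i; rewrite !ffunE (bigD1 i) //= big1 => [|j /negPf ji].
  by rewrite addr0 !mxE eqxx mulr1n.
by rewrite mxE eq_sym ji mulr0n scale0r.
Qed.

End Theory.

Lemma mx_act_map (M N : lmodType R) (f : {linear M -> N}) X u :
  [ffun i => f (mx_act X u i)] = mx_act X [ffun i => f (u i)].
Proof.
apply/ffunP=> i; rewrite !ffunE linear_sum.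
by apply: eq_bigr => j _; rewrite linearZ ffunE.
Qed.

End MatrixAction.

(** * The module functor attached to a morphism onto a corner of a matrix algebra *)

Section CornerFunctor.
Variables (F : pzRingType) (A B : falgebra F) (m : nat).
Variable f : corner_hom B (mx_alg A m).

Lemma corner_mxM x y : (f x : 'M_m) * (f y : 'M_m) = f (x * y) :> 'M_m.
Proof. by rewrite corner_homM. Qed.

Lemma corner_mxME x y i j :
  (f (x * y) : 'M_m) i j = \sum_h (f x : 'M_m) i h * (f y : 'M_m) h j.
Proof. by rewrite -corner_mxM mxE. Qed.

Lemma corner_mxDE x y i j :
  (f (x + y) : 'M_m) i j = (f x : 'M_m) i j + (f y : 'M_m) i j.
Proof. by rewrite raddfD mxE. Qed.

Lemma corner_mxZE c x i j :
  (f (alg_scal B c * x) : 'M_m) i j = alg_scal A c * (f x : 'M_m) i j.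
Proof. by rewrite corner_homZ [_ * _ : 'M_m]mul_scalar_mx mxE. Qed.

Section CornerModule.
Variable M : lmodType A.

(** As [f] is multiplicative, [f 1] is idempotent, so its fixed columns form the image of [f 1].
    This is where [1] acts as the identity, which makes it a unital [B]-module. *)
Definition corner_pred : pred {ffun 'I_m -> M} :=
  fun u => mx_act (f 1) u == u.

Fact corner_pred_zmod : zmod_closed corner_pred.
Proof.
split=> [|u v]; rewrite !unfold_in /corner_pred ?raddf0 //.
by rewrite mx_act_zmod => /eqP -> /eqP ->.
Qed.

HB.instance Definition _ :=
  GRing.isZmodClosed.Build {ffun 'I_m -> M} corner_pred corner_pred_zmod.

Record corner := Corner {
  corner_val : {ffun 'I_m -> M};
  _ : corner_pred corner_val
}.
HB.instance Definition _ := [isSub for corner_val].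
HB.instance Definition _ := [Choice of corner by <:].
HB.instance Definition _ := [SubChoice_isSubZmodule of corner by <:].

Lemma corner_valP (u : corner) : mx_act (f 1) (val u) = val u.
Proof. exact: eqP (valP u). Qed.

Fact corner_scale_proof (b : B) (u : {ffun 'I_m -> M}) :
  corner_pred (mx_act (f b) u).
Proof. by rewrite /corner_pred mx_actM corner_mxM mul1r. Qed.

Definition corner_scale (b : B) (u : corner) : corner :=
  Corner (corner_scale_proof b (val u)).

Fact corner_scaleA a b u :
  corner_scale a (corner_scale b u) = corner_scale (a * b) u.
Proof. by apply: val_inj; rewrite /= mx_actM corner_mxM. Qed.
Fact corner_scale1 : left_id 1 corner_scale.
Proof. by move=> u; apply: val_inj; rewrite /= corner_valP. Qed.
Fact corner_scaleDr : right_distributive corner_scale +%R.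
Proof. by move=> b u v; apply: val_inj; rewrite /= raddfD. Qed.
Fact corner_scaleDl u : {morph corner_scale^~ u : a b / a + b}.
Proof. by move=> a b; apply: val_inj; rewrite /= raddfD mx_actDl. Qed.

HB.instance Definition _ := GRing.Zmodule_isLmodule.Build B corner
  corner_scaleA corner_scale1 corner_scaleDr corner_scaleDl.

Lemma val_cornerZ (b : B) (u : corner) : val (b *: u) = mx_act (f b) (val u).
Proof. by []. Qed.

Lemma val_cornerD (u v : corner) : val (u + v) = val u + val v.
Proof. exact: raddfD. Qed.

Lemma val_corner_sum (I : Type) (r : seq I) (P : pred I) (u : I -> corner) :
  val (\sum_(i <- r | P i) u i) = \sum_(i <- r | P i) val (u i).
Proof. exact: raddf_sum. Qed.

(** Since [f] is [F]-linear, the scalar [c] acts as [c] times [f 1], and [f 1] fixes [u]. This makes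
    the functor below [F]-linear on morphisms. *)
Lemma val_corner_scal (c : F) (u : corner) :
  val (alg_scal B c *: u) = [ffun i => alg_scal A c *: val u i].
Proof.
rewrite val_cornerZ -[alg_scal B c]mulr1 corner_homZ -mx_actM corner_valP.
exact: mx_act_scalar.
Qed.

End CornerModule.

Section CornerMap.
Variables (M N : lmodType A) (g : {linear M -> N}).

Fact corner_map_proof (u : corner M) : corner_pred [ffun i => g (val u i)].
Proof. by rewrite /corner_pred -mx_act_map corner_valP. Qed.

Definition corner_map (u : corner M) : corner N := Corner (corner_map_proof u).

Fact corner_map_linear : linear corner_map.
Proof.
move=> b u v; apply: val_inj; rewrite /= -mx_act_map.
by apply/ffunP=> i; rewrite !ffunE linearD.
Qed.

HB.instance Definition _ := GRing.isLinear.Build B (corner M) (corner N) _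
  corner_map corner_map_linear.

End CornerMap.

(** In concrete form this is tensoring over [A] with the [B]-[A]-bimodule of columns in [A^m] fixed
    by [f 1]. It stays transparent because the isomorphisms below must see the underlying
    corners. *)
Definition corner_functor : lin_functor A B.
Proof.
apply: (@LinFunctor F A B (fun M => corner M : lmodType B)
  (fun M N g => corner_map g : {linear corner M -> corner N})).
- by move=> M u; apply: val_inj; apply/ffunP=> i; rewrite ffunE.
- by move=> M N K g h u; apply: val_inj; apply/ffunP=> i; rewrite !ffunE.
move=> M N c g1 g2 h hE u; apply: val_inj.
by rewrite val_cornerD val_corner_scal; apply/ffunP=> i; rewrite !ffunE hE.
Defined.

End CornerFunctor.

(** * When the composite of two corner functors is isomorphic to the identity *)

Section CornerComposition.
Variables (F : pzRingType) (A B : falgebra F) (k m : nat).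
Variables (phi : corner_hom A (mx_alg B m)) (psi : corner_hom B (mx_alg A k)).
Variables (w w' : 'I_k -> 'I_m -> B).
Hypothesis w_sum : \sum_j \sum_l w' j l * w j l = 1.

(* [phi (psi y)], computed entrywise, is [w y w'] for the column [w] and the
   row [w'] with [k * m] entries. *)
Definition conjugation_at (y : B) : Prop := forall j j' l l',
  (phi ((psi y : 'M_k) j j') : 'M_m) l l' = w j l * y * w' j' l'.

Lemma conjugation_atD x y :
  conjugation_at x -> conjugation_at y -> conjugation_at (x + y).
Proof.
move=> cx cy j j' l l'.
by rewrite corner_mxDE raddfD mxE cx cy mulrDr mulrDl.
Qed.

Lemma conjugation_atZ c x :
  conjugation_at x -> conjugation_at (alg_scal B c * x).
Proof.
move=> cx j j' l l'.
by rewrite !corner_mxZE cx !mulrA alg_scalC.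
Qed.

(** In [(w x w') (w y w')] the inner product [w' w] is [1] by [w_sum]. Hence the conjugation formula
    need only be checked on generators. *)
Lemma conjugation_atM x y :
  conjugation_at x -> conjugation_at y -> conjugation_at (x * y).
Proof.
move=> cx cy j j' l l'; rewrite corner_mxME raddf_sum summxE.
transitivity (\sum_i \sum_h (w j l * x) * (w' i h * w i h) * (y * w' j' l')).
  apply: eq_bigr => i _; rewrite corner_mxME.
  by apply: eq_bigr => h _; rewrite cx cy !mulrA.
under eq_bigr => i _ do rewrite -mulr_suml -mulr_sumr.
by rewrite -mulr_suml -mulr_sumr w_sum mulr1 !mulrA.
Qed.

Section Unit.
Hypothesis conj : forall y, conjugation_at y.
Variable N : lmodType B.

Lemma conjugation_w y j l :
  \sum_j' \sum_l' w j l * y * w' j' l' * w j' l' = w j l * y.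
Proof.
rewrite -[RHS]mulr1 -w_sum mulr_sumr; apply: eq_bigr => i _.
by rewrite mulr_sumr; apply: eq_bigr => h _; rewrite mulrA.
Qed.

Definition unit_row (n : N) (j : 'I_k) : {ffun 'I_m -> N} :=
  [ffun l => w j l *: n].

(** Here [y] acts through [w y w'], and [w' w = 1] turns [w y w' (w n)] into [w (y n)]. So
    multiplication by the column [w] intertwines the two actions. *)
Lemma unit_rowZ (y : B) (n : N) (j : 'I_k) :
  \sum_j' mx_act (phi ((psi y : 'M_k) j j')) (unit_row n j') =
  unit_row (y *: n) j.
Proof.
apply/ffunP=> l; rewrite sum_ffunE ffunE scalerA -conjugation_w scaler_suml.
apply: eq_bigr => j' _; rewrite ffunE scaler_suml; apply: eq_bigr => l' _.
by rewrite ffunE conj scalerA.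
Qed.

Fact unit_row_proof (n : N) (j : 'I_k) : corner_pred phi (unit_row n j).
Proof.
(* Writing [n] as [1 *: n] exhibits the row as a sum of vectors in the image of [phi], each of which
   absorbs [phi 1]. *)
apply/eqP; rewrite -[n]scale1r -unit_rowZ raddf_sum /=; apply: eq_bigr => j' _.
by rewrite mx_actM corner_mxM mul1r.
Qed.

Definition unit_fun (n : N) : {ffun 'I_k -> corner phi N} :=
  [ffun j => Corner (unit_row_proof n j)].

Lemma unit_funZ (y : B) (n : N) :
  mx_act (psi y) (unit_fun n) = unit_fun (y *: n).
Proof.
apply/ffunP=> j; rewrite !ffunE; apply: val_inj.
rewrite val_corner_sum /= -unit_rowZ; apply: eq_bigr => j' _.
by rewrite ffunE.
Qed.

Fact unit_proof (n : N) : corner_pred psi (unit_fun n).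
Proof. by rewrite /corner_pred unit_funZ scale1r. Qed.

Definition unit_map (n : N) : corner psi (corner phi N) :=
  Corner (unit_proof n).

Fact unit_map_linear : linear unit_map.
Proof.
move=> y u v; apply: val_inj.
rewrite val_cornerD val_cornerZ unit_funZ; apply/ffunP=> j.
rewrite !ffunE; apply: val_inj; rewrite val_cornerD.
by apply/ffunP=> l; rewrite !ffunE scalerDr.
Qed.

HB.instance Definition _ := GRing.isLinear.Build B N
  (corner psi (corner phi N)) _ unit_map unit_map_linear.

Definition unit_inv (u : corner psi (corner phi N)) : N :=
  \sum_j \sum_l w' j l *: val (val u j) l.

Lemma unit_mapK : cancel unit_map unit_inv.
Proof.
move=> n; rewrite /unit_inv -[RHS]scale1r -w_sum scaler_suml.
apply: eq_bigr => j _; rewrite scaler_suml; apply: eq_bigr => l _.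
by rewrite !ffunE scalerA.
Qed.

(** The composite is the action of [w w'], which is [phi (psi 1)] by [conj], that is, the action of
    [1] on the double corner. *)
Lemma unit_invK : cancel unit_inv unit_map.
Proof.
move=> u; rewrite -[RHS]scale1r; apply: val_inj; rewrite val_cornerZ.
apply/ffunP=> j; rewrite !ffunE; apply: val_inj; rewrite val_corner_sum.
apply/ffunP=> l; rewrite sum_ffunE !ffunE scaler_sumr.
apply: eq_bigr => j' _; rewrite ffunE scaler_sumr; apply: eq_bigr => l' _.
by rewrite conj mulr1 scalerA.
Qed.

End Unit.

Lemma corner_comp_iso :
  (forall y, conjugation_at y) ->
  comp_iso_id (corner_functor psi) (corner_functor phi).
Proof.
move=> conj; exists (fun N : lmodType B =>
  unit_map conj (N := N) : {linear N -> corner psi (corner phi N)}).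
split=> [N|M N g n].
  by exists (unit_inv (N := N)); [exact: unit_mapK | exact: unit_invK].
apply: val_inj; apply/ffunP=> j; rewrite !ffunE.
apply: val_inj; apply/ffunP=> l; rewrite !ffunE.
by rewrite linearZ.
Qed.

End CornerComposition.

(** * Universal properties of the quotient, free and path algebras *)

Local Open Scope quotient_scope.

Section QuotientLift.
Variables (F : pzRingType) (A : falgebra F) (S : A -> Prop).

Definition quot_pi (x : A) : quot_alg S := \pi_(quot_ring S) x.

Fact quot_pi_zmod : zmod_morphism quot_pi.
Proof. by move=> x y; rewrite /quot_pi -pi_qadd -pi_qopp. Qed.
Fact quot_pi_monoid : monoid_morphism quot_pi.
Proof. by split=> [|x y]; rewrite // /quot_pi -pi_qmul. Qed.
HB.instance Definition _ :=
  GRing.isZmodMorphism.Build A (quot_alg S) quot_pi quot_pi_zmod.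
HB.instance Definition _ :=
  GRing.isMonoidMorphism.Build A (quot_alg S) quot_pi quot_pi_monoid.

Lemma quot_pi_scal c : quot_pi (alg_scal A c) = alg_scal (quot_alg S) c.
Proof. by []. Qed.

Fact quot_piZ c x :
  quot_pi (alg_scal A c * x) = alg_scal (quot_alg S) c * quot_pi x.
Proof. by rewrite rmorphM. Qed.

Definition quot_pi_hom : corner_hom A (quot_alg S) :=
  CornerHom quot_pi_zmod quot_pi_monoid.2 quot_piZ.

Lemma quot_pi_ind (P : quot_alg S -> Prop) :
  (forall x, P (quot_pi x)) -> forall y, P y.
Proof. exact: quot_ringW. Qed.

Lemma quot_pi_rel x : S x -> quot_pi x = 0.
Proof.
move=> Sx; rewrite -(rmorph0 quot_pi); apply: quot_ring_eq.
by rewrite subr0 => I _; apply.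
Qed.

Variables (B : falgebra F) (f : corner_hom A B).
Hypothesis f_rel : forall x, S x -> f x = 0.

(** The kernel of [f] is one of the two-sided ideals containing [S]. *)
Lemma corner_hom_ideal x : ideal_gen S x -> f x = 0.
Proof.
move=> /(_ (fun x' => f x' = 0)); apply=> //.
split=> [|x' y fx fy|a x' fx]; first exact: raddf0.
  by rewrite corner_homB fx fy subr0.
by rewrite !corner_homM fx mul0r mulr0.
Qed.

Definition quot_lift_fun (y : quot_alg S) : B := f (repr (y : quot_ring S)).

Lemma quot_lift_pi x : quot_lift_fun (quot_pi x) = f x.
Proof.
apply/eqP; rewrite -subr_eq0 /quot_lift_fun -corner_homB; apply/eqP.
by apply: corner_hom_ideal; apply: quot_ring_repr.
Qed.

Fact quot_lift_zmod : zmod_morphism quot_lift_fun.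
Proof.
move=> x y; elim/quot_pi_ind: x => x; elim/quot_pi_ind: y => y.
by rewrite -rmorphB !quot_lift_pi corner_homB.
Qed.
Fact quot_liftM : {morph quot_lift_fun : x y / x * y}.
Proof.
move=> x y; elim/quot_pi_ind: x => x; elim/quot_pi_ind: y => y.
by rewrite -rmorphM !quot_lift_pi corner_homM.
Qed.
Fact quot_liftZ c x :
  quot_lift_fun (alg_scal (quot_alg S) c * x) = alg_scal B c * quot_lift_fun x.
Proof.
elim/quot_pi_ind: x => x.
by rewrite -quot_pi_scal -rmorphM !quot_lift_pi corner_homZ.
Qed.

Definition quot_lift : corner_hom (quot_alg S) B :=
  CornerHom quot_lift_zmod quot_liftM quot_liftZ.

End QuotientLift.

Section LinearExtension.
Variables (F : fieldType) (K : choiceType) (B : falgebra F) (h : K -> B).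

Definition malg_ext (x : {malg F[K]}) : B :=
  \sum_(k <- msupp x) alg_scal B x@_k * h k.

(** Enlarging the index set beyond the support puts elements with different supports under one
    common sum. *)
Lemma malg_extEw (d : {fset K}) x : (msupp x `<=` d)%fset ->
  malg_ext x = \sum_(k <- d) alg_scal B x@_k * h k.
Proof.
move=> le; rewrite /malg_ext (big_fset_incl _ le) //= => k _ /mcoeff_outdom ->.
by rewrite rmorph0 mul0r.
Qed.

Fact malg_ext_zmod : zmod_morphism malg_ext.
Proof.
move=> x y; rewrite (malg_extEw (msuppB_le x y)).
rewrite (malg_extEw (fsubsetUl _ (msupp y))).
rewrite (malg_extEw (fsubsetUr (msupp x) _)) -sumrB.
by apply: eq_bigr => k _; rewrite mcoeffB rmorphB mulrBl.
Qed.

Lemma malg_extZ c x : malg_ext (c *: x) = alg_scal B c * malg_ext x.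
Proof.
rewrite (malg_extEw (msuppZ_le _ _)) mulr_sumr; apply: eq_bigr => k _.
by rewrite mcoeffZ rmorphM mulrA.
Qed.

Lemma malg_extU k : malg_ext << k >> = h k.
Proof.
by rewrite (malg_extEw msuppU_le) big_seq_fset1 mcoeffUU rmorph1 mul1r.
Qed.

End LinearExtension.

(** Spanning is encoded as an induction principle, so that bilinear identities reduce to the family
    [e] by two inductions. *)
Definition spanning (F : pzRingType) (A : falgebra F) I (e : I -> A) :=
  forall P : A -> Prop, P 0 -> (forall x y, P x -> P y -> P (x + y)) ->
    (forall c i, P (alg_scal A c * e i)) -> forall x, P x.

Lemma spanning_homM (F : pzRingType) (A B : falgebra F) I (e : I -> A)
    (f : A -> B) :
  spanning e -> zmod_morphism f ->
  (forall c x, f (alg_scal A c * x) = alg_scal B c * f x) ->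
  (forall i j, f (e i * e j) = f (e i) * f (e j)) ->
  {morph f : x y / x * y}.
Proof.
move=> sp fB fZ fM x y.
pose fH := HB.pack_for {additive A -> B} f
  (GRing.isZmodMorphism.Build A B f fB).
have f0 : f 0 = 0 := raddf0 fH.
have fD a b : f (a + b) = f a + f b := raddfD fH a b.
elim/sp: x => [|x x' IHx IHx'|c i]; first by rewrite mul0r f0 mul0r.
  by rewrite mulrDl !fD IHx IHx' mulrDl.
rewrite -mulrA !fZ -mulrA; congr (_ * _).
elim/sp: y => [|y y' IHy IHy'|d j]; first by rewrite mulr0 f0 mulr0.
  by rewrite mulrDr !fD IHy IHy' mulrDr.
rewrite mulrA -alg_scalC -mulrA !fZ fM.
by rewrite !mulrA alg_scalC.
Qed.

Section FreeLift.
Variables (F : fieldType) (X : choiceType) (B : falgebra F).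

Lemma free_scal_mul c (x : free_alg F X) :
  alg_scal (free_alg F X) c * x = c *: (x : {malg F[{fmonom X}]}).
Proof. exact: mul_malgC. Qed.

Lemma free_spanning :
  spanning (fun k : {fmonom X} => << k >> : free_alg F X).
Proof.
move=> P P0 PD PZ x; rewrite [x]monalgE; apply: big_ind => // k _.
have := PZ x@_k k; rewrite free_scal_mul.
congr P; apply/malgP=> l.
by rewrite mcoeffZ !mcoeffU mulr_natr.
Qed.

Lemma free_monomM (k l : {fmonom X}) :
  (<< k >> : free_alg F X) * << l >> = << mmul k l >>.
Proof. by apply: etrans (fgmulUU _ _ _ _) _; rewrite mulr1. Qed.

Lemma free_alg_ind (P : free_alg F X -> Prop) :
  P 1 -> (forall i, P (free_gen F i)) ->
  (forall x y, P x -> P y -> P (x + y)) ->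
  (forall x y, P x -> P y -> P (x * y)) ->
  (forall c x, P x -> P (alg_scal _ c * x)) ->
  forall x, P x.
Proof.
move=> P1 Pg PD PM PZ; apply: free_spanning => // [|c k].
  (* The case of zero is [1] scaled by zero. *)
  by have := PZ 0 1 P1; rewrite rmorph0 mul0r.
apply: PZ; rewrite -[k]fmK; elim: (k : seq X) => [|i s IHs].
  by rewrite -fmoneE.
have := PM _ _ (Pg i) IHs; rewrite free_monomM; congr (P << _ >>).
by apply: val_inj; rewrite /= fmM fmU.
Qed.

Variables (e : B) (g : X -> B).
Hypotheses (e_id : e * e = e) (eg : forall i, e * g i = g i * e).

(** The leading [e] sends the empty word to [e] rather than to [1], so the lift lands in the corner
    at [e]. *)
Definition free_lift_mon (k : {fmonom X}) : B := e * \prod_(i <- k) g i.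

Fact free_lift_comm (s : seq X) :
  e * \prod_(i <- s) g i = \prod_(i <- s) g i * e.
Proof.
elim: s => [|i s IH]; first by rewrite big_nil mulr1 mul1r.
by rewrite big_cons mulrA eg -mulrA IH mulrA.
Qed.

Definition free_lift_fun : free_alg F X -> B := malg_ext free_lift_mon.

Fact free_lift_zmod : zmod_morphism free_lift_fun.
Proof. exact: malg_ext_zmod. Qed.

Fact free_liftZ c x :
  free_lift_fun (alg_scal (free_alg F X) c * x) =
  alg_scal B c * free_lift_fun x.
Proof. by rewrite free_scal_mul; exact: malg_extZ. Qed.

Fact free_liftM : {morph free_lift_fun : x y / x * y}.
Proof.
apply: (spanning_homM free_spanning free_lift_zmod free_liftZ) => k l.
rewrite free_monomM /free_lift_fun !malg_extU /free_lift_mon fmM big_cat /=.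
by rewrite (free_lift_comm k) -mulrA (mulrA e e) e_id !mulrA free_lift_comm.
Qed.

Definition free_lift : corner_hom (free_alg F X) B :=
  CornerHom free_lift_zmod free_liftM free_liftZ.

Lemma free_lift_gen i : free_lift (free_gen F i) = e * g i.
Proof. by rewrite /= /free_lift_fun malg_extU /free_lift_mon fmU big_seq1. Qed.

Lemma free_lift1 : free_lift 1 = e.
Proof.
apply: etrans (malg_extU _ _) _.
by rewrite /free_lift_mon fm1 big_nil mulr1.
Qed.

End FreeLift.

Section PathLift.
Variables (F : fieldType) (Q : quiver) (B : falgebra F).
Local Notation FQ := (path_alg F Q).

Lemma path_scal_mul c (x : FQ) :
  alg_scal FQ c * x = c *: (x : path_ring F Q).
Proof.
by apply: etrans (pmulZl c (pone F Q) x) _; rewrite pmul1.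
Qed.

Lemma path_spanning : spanning (fun p : qpath Q => path_elt F p : FQ).
Proof.
move=> P P0 PD PZ; apply: path_ring_ind => // c p.
by rewrite -path_scal_mul.
Qed.

Lemma path_eltM (p q : qpath Q) :
  (path_elt F p : FQ) * path_elt F q = path_mul F p q.
Proof. exact: pmulUU. Qed.

Lemma path_elt_comp (p q s : qpath Q) : path_tgt p = path_src q ->
  val s = (path_src p, (val p).2 ++ (val q).2) ->
  (path_elt F p : FQ) * path_elt F q = path_elt F s.
Proof.
move=> pq sE; rewrite path_eltM (path_mulT F pq); congr (path_elt F _).
exact: val_inj.
Qed.

Lemma path_elt_rcons v s a (pa : is_path v (rcons s a)) (ps : is_path v s) :
  path_elt F (exist _ (v, rcons s a) pa) =
  (path_elt F (exist _ (v, s) ps) : FQ) * parrow F a.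
Proof.
apply/esym/path_elt_comp; last by rewrite /= cats1.
by move: pa; rewrite -cats1 is_path_cat /= ps /= andbT => /eqP.

Qed.

Lemma path_alg_ind (P : FQ -> Prop) :
  (forall v, P (pvertex F v)) -> (forall a, P (parrow F a)) ->
  (forall x y, P x -> P y -> P (x + y)) ->
  (forall x y, P x -> P y -> P (x * y)) ->
  (forall c x, P x -> P (alg_scal _ c * x)) ->
  P 0 -> forall x, P x.
Proof.
move=> Pv Pa PD PM PZ P0; apply: path_spanning => // c p.
apply: PZ; case: p => [[v s] /= ps].
elim/last_ind: s ps => [|s a IHs] ps.
  by have := Pv v; congr (P (path_elt _ _)); apply: val_inj.
have ps' : is_path v s by move: ps; rewrite -cats1 is_path_cat => /andP[].
by rewrite (path_elt_rcons ps ps'); apply: PM.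
Qed.

Variables (f : vertex Q -> B) (g : arrow Q -> B).
Hypotheses (ff : forall v, f v * f v = f v)
  (ff0 : forall v w, v != w -> f v * f w = 0)
  (fg : forall a, f (src a) * g a = g a)
  (gf : forall a, g a * f (tgt a) = g a).

(** The leading idempotent gives constant paths their value; on a longer path the first arrow
    absorbs it by [fg]. *)
Definition path_lift_path (p : qpath Q) : B :=
  f (val p).1 * \prod_(a <- (val p).2) g a.

Fact path_lift_tgt v s : is_path v s ->
  (f v * \prod_(a <- s) g a) * f (endpoint v s) = f v * \prod_(a <- s) g a.
Proof.
elim: s v => [|a s IHs] v /=; first by rewrite big_nil mulr1 ff.
case/andP=> /eqP <- ps; rewrite big_cons mulrA fg.
(* Inserting [f (tgt a)] after [g a] makes the remaining factors the value of the path that starts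
   at [tgt a]. *)
by rewrite -{1 2}(gf a) -!mulrA [f _ * (_ * _)]mulrA IHs.
Qed.

Definition path_lift_fun : FQ -> B := malg_ext path_lift_path.

Lemma path_lift_elt p : path_lift_fun (path_elt F p) = path_lift_path p.
Proof. exact: malg_extU. Qed.

Fact path_lift_zmod : zmod_morphism path_lift_fun.
Proof. exact: malg_ext_zmod. Qed.

Fact path_liftZ c x :
  path_lift_fun (alg_scal FQ c * x) = alg_scal B c * path_lift_fun x.
Proof. by rewrite path_scal_mul; exact: malg_extZ. Qed.

(** Insert the idempotent at the target of [p] between the two values. If the paths compose, it
    merges with the source idempotent of [q]; otherwise orthogonality makes the product vanish, as
    in the path algebra. *)
Lemma path_lift_pathM p q :
  path_lift_fun (path_mul F p q) = path_lift_path p * path_lift_path q.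
Proof.
rewrite /path_lift_path -(path_lift_tgt (valP p)) -/(path_tgt p) -mulrA.
rewrite [f (path_tgt p) * _]mulrA.
have [pq|pq] := eqVneq (path_tgt p) (path_src q).
  rewrite (path_mulT _ pq); apply: etrans (path_lift_elt _) _.
  rewrite /path_lift_path /= big_cat /= -/(path_src q) -pq ff.
  by rewrite !mulrA path_lift_tgt // (valP p).
rewrite (path_mulF _ (elimN eqP pq)) (ff0 pq) mul0r mulr0.
by have := path_liftZ 0 0; rewrite mulr0 rmorph0 mul0r.
Qed.

Fact path_liftM : {morph path_lift_fun : x y / x * y}.
Proof.
apply: (spanning_homM path_spanning path_lift_zmod path_liftZ) => p q.
apply: etrans (congr1 path_lift_fun (path_eltM p q)) _.
apply: etrans (path_lift_pathM p q) _; apply: esym.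
exact: congr2 (path_lift_elt p) (path_lift_elt q).
Qed.

Definition path_lift : corner_hom FQ B :=
  CornerHom path_lift_zmod path_liftM path_liftZ.

Lemma path_lift_vertex v : path_lift (pvertex F v) = f v.
Proof. by rewrite [LHS]path_lift_elt /path_lift_path big_nil mulr1. Qed.

Lemma path_lift_arrow a : path_lift (parrow F a) = g a.
Proof. by rewrite [LHS]path_lift_elt /path_lift_path big_seq1 fg. Qed.

End PathLift.

(** * The two algebras *)

Section VertexRelations.
Variables (F : fieldType) (Q : quiver).
Local Notation FQ := (path_alg F Q).
Local Notation e_ := (@pvertex F Q).
Local Notation a_ := (@parrow F Q).

Lemma pvertex_id v : e_ v * e_ v = e_ v.
Proof. exact: path_elt_comp. Qed.

Lemma pvertex_orth v w : v != w -> e_ v * e_ w = 0.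
Proof. by move=> /eqP vw; rewrite /pvertex path_eltM path_mulF. Qed.

Lemma pvertex_sum : \sum_v e_ v = 1.
Proof. by []. Qed.

Lemma pvertex_arrow a : e_ (src a) * a_ a = a_ a.
Proof. exact: path_elt_comp. Qed.

Lemma parrow_vertex a : a_ a * e_ (tgt a) = a_ a.
Proof. exact: path_elt_comp. Qed.

End VertexRelations.

Lemma big_option (V : nmodType) (T : finType) (G : option T -> V) :
  \sum_v G v = G None + \sum_i G (Some i).
Proof.
rewrite (bigD1 None) //=; congr (_ + _).
rewrite (reindex_omap Some id) => [|[]//].
by apply: eq_bigl => i; rewrite eqxx.
Qed.

(* Otherwise unification unfolds these into quotients and finite maps, and
   effectively diverges. *)
#[local] Opaque quot_pi free_gen pvertex parrow.

(** * Both algebras as universal recipients of systems of elements *)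

Section Presentations.
Variables (F : fieldType) (n : nat) (r : 'I_n -> F).

(* [e] plays the role of the unit of [A(n)]. *)
Record A_system (B : falgebra F) (e p : B) (q : 'I_n -> B) : Prop := ASystem {
  A_ep : e * p = p;
  A_pe : p * e = p;
  A_pp : p * p = p;
  A_qq : forall i, q i * q i = q i;
  A_orth : forall i j, i != j -> q i * q j = 0;
  A_qpq : forall i, q i * p * q i = alg_scal B (r i) * q i;
  A_sum : \sum_i q i = e
}.

(** [star_xy] and [star_yx] are the components of the preprojective relation at the center and at
    the boundary vertices. The sum of the [f v] may differ from [1], so a system can live in a
    corner of [B]. *)
Record star_system (B : falgebra F) (f : option 'I_n -> B) (x y : 'I_n -> B) :
    Prop := StarSystem {
  star_ff : forall v, f v * f v = f v;
  star_orth : forall v w, v != w -> f v * f w = 0;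
  star_fx : forall i, f None * x i = x i;
  star_xf : forall i, x i * f (Some i) = x i;
  star_fy : forall i, f (Some i) * y i = y i;
  star_yf : forall i, y i * f None = y i;
  star_xy : \sum_i x i * y i = f None;
  star_yx : forall i, y i * x i = alg_scal B (r i) * f (Some i)
}.

Local Notation A := (A_alg r).
Local Notation Fr := (free_alg F (option 'I_n)).
Local Notation gen o := (quot_pi (@A_relation F n r) (free_gen F o)).

Lemma corner_hom_qpq (C B : falgebra F) (h : corner_hom C B) (a b : C) c :
  h (a * b * a - alg_scal C c * a) = h a * h b * h a - alg_scal B c * h a.
Proof. by rewrite corner_homB corner_homZ !corner_homM. Qed.

Lemma A_relation_system (B : falgebra F) (h : corner_hom Fr B) :
  h 1 = 1 -> (forall x, A_relation r x -> h x = 0) ->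
  A_system 1 (h (free_gen F None)) (fun i => h (free_gen F (Some i))).
Proof.
move=> h1 rel; split=> [|||i|i j ij|i|].
- by rewrite mul1r.
- by rewrite mulr1.
- have /rel/eqP := A_rel_P r.
  by rewrite corner_homB subr_eq0 expr2 corner_homM => /eqP.
- have /rel/eqP := A_rel_q r i.
  by rewrite corner_homB subr_eq0 expr2 corner_homM => /eqP.
- by have /rel := A_rel_qq r ij; rewrite corner_homM.
- by have /rel/eqP := A_rel_qPq r i; rewrite corner_hom_qpq subr_eq0 => /eqP.
have /rel/eqP := A_rel_sum r.
by rewrite corner_homB subr_eq0 h1 raddf_sum => /eqP.
Qed.

Lemma A_alg_system : A_system (1 : A) (gen None) (fun i => gen (Some i)).
Proof.
apply: (@A_relation_system A (quot_pi_hom (A_relation r))) => [|x].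
  exact: rmorph1.
exact: quot_pi_rel.
Qed.

Lemma A_alg_ind (P : A -> Prop) :
  P 1 -> P (gen None) -> (forall i, P (gen (Some i))) ->
  (forall x y, P x -> P y -> P (x + y)) ->
  (forall x y, P x -> P y -> P (x * y)) ->
  (forall c x, P x -> P (alg_scal _ c * x)) ->
  forall x, P x.
Proof.
move=> P1 Pp Pq PD PM PZ; apply: quot_pi_ind.
apply: (@free_alg_ind F _ (fun x => P (quot_pi _ x))).
- exact: P1.
- by case=> [i|]; [exact: Pq | exact: Pp].
- by move=> x y; rewrite rmorphD; exact: PD.
- by move=> x y; rewrite rmorphM; exact: PM.
by move=> c x /(PZ c); rewrite -quot_pi_scal -rmorphM.
Qed.

(** Orthogonality and [A_sum] make [e] a two-sided unit for every [q i], as it is for [p]. The free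
    lift with unit [e] therefore exists, and it kills each defining relation. *)
Lemma A_alg_lift (B : falgebra F) (e p : B) (q : 'I_n -> B) :
  A_system e p q ->
  exists f : corner_hom A B,
    [/\ f 1 = e, f (gen None) = p & forall i, f (gen (Some i)) = q i].
Proof.
case=> ep pe pp qq orth qpq sumq.
have eq i : e * q i = q i.
  rewrite -sumq mulr_suml (bigD1 i) //= big1 => [|j ji]; last exact: orth.
  by rewrite addr0 qq.
have qe i : q i * e = q i.
  rewrite -sumq mulr_sumr (bigD1 i) //= big1 => [|j ji].
    by rewrite addr0 qq.
  by rewrite orth // eq_sym.
have ee : e * e = e by rewrite -{2}sumq mulr_sumr (eq_bigr _ (fun i _ => eq i)).
pose g o := if o is Some i then q i else p.
have eg o : e * g o = g o by case: o.
have eg_comm o : e * g o = g o * e by rewrite eg; case: o => /=.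
pose h := free_lift ee eg_comm.
have hg o : h (free_gen F o) = g o by rewrite free_lift_gen eg.
have h1 : h 1 = e by exact: free_lift1.
have hrel x : A_relation r x -> h x = 0.
  case=> [|i|i j ij|i|].
  - by rewrite corner_homB expr2 corner_homM hg /= pp subrr.
  - by rewrite corner_homB expr2 corner_homM hg /= qq subrr.
  - by rewrite corner_homM !hg /= orth.
  - by rewrite corner_hom_qpq !hg /= qpq subrr.
  rewrite corner_homB raddf_sum h1 (eq_bigr q) => [|i _]; last exact: hg.
  by rewrite sumq subrr.
have hpi t : quot_lift hrel (quot_pi _ t) = h t by exact: quot_lift_pi.
exists (quot_lift hrel); split=> [||i].
- by rewrite -[RHS]h1 -hpi rmorph1.
- by rewrite hpi hg.
by rewrite hpi hg.
Qed.

Local Notation star_relation :=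
  (@preproj_relation F (star_quiver n) (star_weight r)).
Local Notation Pi :=
  (@deformed_preprojective F (star_quiver n) (star_weight r)).
Local Notation pi := (quot_pi star_relation).
Local Notation DQ := (double_quiver (star_quiver n)).
Local Notation pv := (fun v : option 'I_n => pi (@pvertex F DQ v)).
Local Notation px := (fun i : 'I_n => pi (@parrow F DQ (inl i))).
Local Notation py := (fun i : 'I_n => pi (@parrow F DQ (inr i))).

Lemma deformed_star_sum : \sum_v pv v = 1 :> Pi.
Proof. by rewrite -rmorph_sum pvertex_sum rmorph1. Qed.

Lemma corner_hom_preproj (C B : falgebra F) (h : corner_hom C B)
    (I J : finType) (a b : I -> C) (e : J -> C) (c : J -> F) :
  h (\sum_i (a i * b i - b i * a i) - \sum_j alg_scal C (c j) * e j) =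
  \sum_i h (a i) * h (b i) - \sum_i h (b i) * h (a i) -
  \sum_j alg_scal B (c j) * h (e j).
Proof.
rewrite -[X in _ = X - _]sumrB corner_homB !raddf_sum.
congr (_ + _); apply: eq_bigr => i _ /=; last by rewrite corner_homZ.
by rewrite corner_homB !corner_homM.
Qed.

(** The single relation is split into its vertex components by multiplying it by the vertex
    idempotents. *)
Lemma preproj_relation_system (B : falgebra F)
    (h : corner_hom (path_alg F DQ) B) :
  (forall x, star_relation x -> h x = 0) ->
  star_system (fun v => h (@pvertex F DQ v))
    (fun i => h (@parrow F DQ (inl i))) (fun i => h (@parrow F DQ (inr i))).
Proof.
move=> hrel.
pose v_ (v : option 'I_n) : B := h (@pvertex F DQ v).
pose x_ i : B := h (@parrow F DQ (inl i)).
pose y_ i : B := h (@parrow F DQ (inr i)).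
have ff v : v_ v * v_ v = v_ v by rewrite -corner_homM pvertex_id.
have orth v w : v != w -> v_ v * v_ w = 0.
  by move=> vw; rewrite -corner_homM pvertex_orth ?raddf0.
have fx i : v_ None * x_ i = x_ i.
  by rewrite -corner_homM (pvertex_arrow F (Q := DQ) (inl i)).
have xf i : x_ i * v_ (Some i) = x_ i.
  by rewrite -corner_homM (parrow_vertex F (Q := DQ) (inl i)).
have fy i : v_ (Some i) * y_ i = y_ i.
  by rewrite -corner_homM (pvertex_arrow F (Q := DQ) (inr i)).
have yf i : y_ i * v_ None = y_ i.
  by rewrite -corner_homM (parrow_vertex F (Q := DQ) (inr i)).
have rel : \sum_i x_ i * y_ i - \sum_i y_ i * x_ i =
    v_ None - \sum_i alg_scal B (r i) * v_ (Some i).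
  have /eqP := hrel _ (erefl _).
  rewrite corner_hom_preproj subr_eq0 => /eqP.
  rewrite [RHS]big_option /= rmorph1 mul1r -!sumrB -sumrN => ->.
  by congr (_ + _); apply: eq_bigr => i _; rewrite rmorphN mulNr.
(* Only [rel] and the incidence identities matter from here on, so the origin of the elements is
   forgotten. *)
change (star_system v_ x_ y_); clearbody v_ x_ y_.
have vx j i : v_ (Some j) * x_ i = 0 by rewrite -fx mulrA orth ?mul0r.
have vy i : v_ None * y_ i = 0 by rewrite -fy mulrA orth ?mul0r.
split=> // [|j].
  (* At the center the terms [y_ i * x_ i] and the boundary idempotents vanish. *)
  have := congr1 (fun t => v_ None * t) rel; rewrite !mulrBr !mulr_sumr ff.
  rewrite (eq_bigr (fun i => x_ i * y_ i)) => [|i _]; last by rewrite mulrA fx.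
  rewrite [X in _ - X]big1 => [|i _]; last by rewrite mulrA vy mul0r.
  rewrite [X in _ = _ - X]big1 ?subr0 // => i _.
  by rewrite mulrA -alg_scalC -mulrA orth ?mulr0.
(* At the boundary vertex [j] the terms [x_ i * y_ i] and the central idempotent vanish, and only
   the index [j] survives in the other two sums. *)
have := congr1 (fun t => v_ (Some j) * t) rel.
rewrite !mulrBr !mulr_sumr orth // big1 => [|i _]; last first.
  by rewrite mulrA vx mul0r.
rewrite !sub0r => /oppr_inj; rewrite (bigD1 j) //= big1 => [|i ij]; last first.
  by rewrite -(fy i) !mulrA orth ?mul0r // eq_sym.
rewrite addr0 mulrA fy => ->; rewrite (bigD1 j) //= big1 => [|i ij]; last first.
  by rewrite mulrA -alg_scalC -mulrA orth ?mulr0 // eq_sym.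
by rewrite addr0 mulrA -alg_scalC -mulrA ff.
Qed.

Lemma deformed_star_system : star_system (B := Pi) pv px py.
Proof.
exact: (preproj_relation_system (h := quot_pi_hom _) (@quot_pi_rel _ _ _)).
Qed.

Lemma deformed_star_ind (P : Pi -> Prop) :
  (forall v, P (pv v)) -> (forall i, P (px i)) -> (forall i, P (py i)) ->
  (forall x y, P x -> P y -> P (x + y)) ->
  (forall x y, P x -> P y -> P (x * y)) ->
  (forall c x, P x -> P (alg_scal _ c * x)) ->
  forall x, P x.
Proof.
move=> Pv Px Py PD PM PZ; apply: quot_pi_ind.
apply: (@path_alg_ind F DQ (fun x => P (quot_pi _ x))).
- exact: Pv.
- by case=> i; [exact: Px | exact: Py].
- by move=> x y; rewrite rmorphD; exact: PD.
- by move=> x y; rewrite rmorphM; exact: PM.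
- by move=> c x /(PZ c); rewrite -quot_pi_scal -rmorphM.
by have := PZ 0 _ (Pv None); rewrite rmorph0 mul0r rmorph0.
Qed.

Lemma deformed_star_lift (B : falgebra F) (f : option 'I_n -> B)
    (x y : 'I_n -> B) :
  star_system f x y ->
  exists g : corner_hom Pi B,
    [/\ forall v, g (pv v) = f v, forall i, g (px i) = x i
      & forall i, g (py i) = y i].
Proof.
case=> ff orth fx xf fy yf xy yx.
pose z (a : arrow DQ) : B := match a with inl i => x i | inr i => y i end.
have fz a : f (@src DQ a) * z a = z a by case: a.
have zf a : z a * f (@tgt DQ a) = z a by case: a.
pose h := @path_lift F DQ B f z ff orth fz zf.
have hv v : h (@pvertex F DQ v) = f v by exact: path_lift_vertex.
have ha a : h (@parrow F DQ a) = z a by exact: path_lift_arrow.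
have hrel t : star_relation t -> h t = 0.
  move=> ->; rewrite corner_hom_preproj.
  have hx i : h (@parrow F DQ (inl i)) = x i := ha (inl i).
  have hy i : h (@parrow F DQ (inr i)) = y i := ha (inr i).
  rewrite [X in X - _ - _](eq_bigr (fun i => x i * y i)) => [|i _]; last first.
    exact: congr2 (hx i) (hy i).
  rewrite [X in _ - X - _](eq_bigr (fun i => y i * x i)) => [|i _]; last first.
    exact: congr2 (hy i) (hx i).
  rewrite [X in _ - X](eq_bigr (fun v => alg_scal B (star_weight r v) * f v));
    last by move=> v _; exact: congr1 (hv v).
  (* The central term has weight [1] and cancels by [xy]; the boundary terms have weight [- r i] and
     cancel against [y i * x i] by [yx]. *)
  rewrite [X in _ - X]big_option /= rmorph1 mul1r xy opprD addrACA subrr.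
  rewrite add0r -opprD -big_split big1 ?oppr0 // => i _ /=.
  by rewrite yx rmorphN mulNr addrN.
have hpi t : quot_lift hrel (quot_pi _ t) = h t by exact: quot_lift_pi.
exists (quot_lift hrel); split=> [v|i|i]; rewrite hpi.
- exact: hv.
- exact: (ha (inl i)).
exact: (ha (inr i)).
Qed.
End Presentations.

(** * Matrix units, and morphisms viewed as [1 x 1] matrices *)

Section ElementaryMatrix.
Variables (F : pzRingType) (A : falgebra F) (m : nat).
Implicit Types (i j k l : 'I_m) (a b : A).

Definition elem_mx i j a : mx_alg A m :=
  \matrix_(k, l) (a *+ ((k == i) && (l == j))).

Fact elem_mx_zmod i j : zmod_morphism (elem_mx i j).
Proof. by move=> a b; apply/matrixP=> k l; rewrite !mxE mulrnBl. Qed.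
HB.instance Definition _ i j := GRing.isZmodMorphism.Build A (mx_alg A m)
  (elem_mx i j) (elem_mx_zmod i j).

Lemma elem_mxE i j a k l :
  (elem_mx i j a : 'M_m) k l = a *+ ((k == i) && (l == j)).
Proof. by rewrite mxE. Qed.

Lemma elem_mxM i j l a b : elem_mx i j a * elem_mx j l b = elem_mx i l (a * b).
Proof.
apply/matrixP=> k h; rewrite !mxE (bigD1 j) //= big1 => [|j' jj'].
  by rewrite !mxE eqxx addr0 andbT mulrnAl mulrnAr -mulrnA mulnb andbC.
by rewrite !mxE (negPf jj') andbF mul0r.
Qed.

Lemma elem_mx_orth i j k l a b : j != k -> elem_mx i j a * elem_mx k l b = 0.
Proof.
move=> /negPf jk; apply/matrixP=> s t; rewrite !mxE big1 // => h _.
rewrite !mxE.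
by have [->|_] := eqVneq h j; rewrite ?jk ?andbF ?mul0r ?mulr0.
Qed.

Lemma elem_mxZ i j c a :
  elem_mx i j (alg_scal A c * a) = alg_scal (mx_alg A m) c * elem_mx i j a.
Proof.
rewrite [RHS](mul_scalar_mx (alg_scal A c) (elem_mx i j a : 'M_m)).
by apply/matrixP=> k l; rewrite !mxE mulrnAr.
Qed.

End ElementaryMatrix.

Section ScalarCorner.
Variables (F : pzRingType) (A B : falgebra F) (f : corner_hom A B).

Definition corner_mx1_fun (x : A) : mx_alg B 1 := (f x)%:M.

Fact corner_mx1_zmod : zmod_morphism corner_mx1_fun.
Proof. by move=> x y; rewrite /corner_mx1_fun corner_homB raddfB. Qed.
Fact corner_mx1M : {morph corner_mx1_fun : x y / x * y}.
Proof. by move=> x y; rewrite /corner_mx1_fun corner_homM scalar_mxM. Qed.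
Fact corner_mx1Z c x :
  corner_mx1_fun (alg_scal A c * x) =
  alg_scal (mx_alg B 1) c * corner_mx1_fun x.
Proof. by rewrite /corner_mx1_fun corner_homZ scalar_mxM. Qed.

(** Corner functors are built from morphisms into matrix algebras; this puts a plain morphism into
    that form. *)
Definition corner_mx1 : corner_hom A (mx_alg B 1) :=
  CornerHom corner_mx1_zmod corner_mx1M corner_mx1Z.

Lemma corner_mx1E x i j : (corner_mx1 x : 'M_1) i j = f x.
Proof. by rewrite /= /corner_mx1_fun !ord1 mxE eqxx. Qed.

End ScalarCorner.

Lemma forall_ord2 (P : 'I_2 -> Prop) : P 0 -> P 1 -> forall i, P i.
Proof.
move=> P0 P1 [[|[|//]] lti].
  by rewrite (_ : Ordinal _ = 0) //; apply: val_inj.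
by rewrite (_ : Ordinal _ = 1) //; apply: val_inj.
Qed.

(** * The two morphisms and the resulting equivalence *)

Section Systems.
Variables (F : fieldType) (n : nat) (r : 'I_n -> F).
Variables (A B : falgebra F).
Variables (p : A) (q : 'I_n -> A) (Asys : A_system r 1 p q).
Variables (f : option 'I_n -> B) (x y : 'I_n -> B) (Bsys : star_system r f x y).
Hypothesis f_sum : \sum_v f v = 1.

Let e := \sum_i f (Some i).
Let X := \sum_i x i.
Let Y := \sum_i y i.

(** At the center, the sum of the [p q_i q_i p] is [p 1 p = p]; at the boundary,
    [q_i p p q_i = q_i p q_i = r_i q_i]. The remaining identities come from idempotence,
    orthogonality and the positions of the matrix units. *)
Lemma elem_mx_star_system :
  star_system (B := mx_alg A 2) r
    (fun v => if v is Some i then elem_mx 0 0 (q i) else elem_mx 1 1 p)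
    (fun i => elem_mx 1 0 (p * q i)) (fun i => elem_mx 0 1 (q i * p)).
Proof.
case: Asys => _ _ pp qq qq0 qpq q_sum.
split=> [[i|]|[i|] [j|]|i|i|i|i||i]; rewrite ?elem_mxM //.
- by rewrite qq.
- by rewrite pp.
- by move=> ij; rewrite qq0 ?raddf0.
- by move=> _; rewrite elem_mx_orth.
- by move=> _; rewrite elem_mx_orth.
- by rewrite mulrA pp.
- by rewrite -mulrA qq.
- by rewrite mulrA qq.
- by rewrite -mulrA pp.
- rewrite (eq_bigr (fun i => elem_mx 1 1 (p * q i * p))) => [|i _].
    by rewrite -raddf_sum -mulr_suml -mulr_sumr q_sum mulr1 pp.
  by rewrite elem_mxM mulrA -[p * q i * q i]mulrA qq.
by rewrite mulrA -[q i * p * p]mulrA pp qpq elem_mxZ.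
Qed.

Lemma star_e1 : e + f None = 1.
Proof. by rewrite addrC -f_sum big_option. Qed.

Lemma star_xf_ne i j : i != j -> x i * f (Some j) = 0.
Proof.
by move=> ij; rewrite -(star_xf Bsys) -mulrA (star_orth Bsys) ?mulr0.
Qed.
Lemma star_fy_ne i j : i != j -> f (Some i) * y j = 0.
Proof.
by move=> ij; rewrite -(star_fy Bsys) mulrA (star_orth Bsys) ?mul0r.
Qed.

Lemma star_Xf i : X * f (Some i) = x i.
Proof.
rewrite mulr_suml (bigD1 i) //= big1 ?addr0 ?(star_xf Bsys) // => j ji.
exact: star_xf_ne.
Qed.
Lemma star_fY i : f (Some i) * Y = y i.
Proof.
rewrite mulr_sumr (bigD1 i) //= big1 ?addr0 ?(star_fy Bsys) // => j ji.
by apply: star_fy_ne; rewrite eq_sym.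
Qed.
Lemma star_f0X : f None * X = X.
Proof. by rewrite mulr_sumr; apply: eq_bigr => i _; exact: (star_fx Bsys). Qed.
Lemma star_Yf0 : Y * f None = Y.
Proof. by rewrite mulr_suml; apply: eq_bigr => i _; exact: (star_yf Bsys). Qed.
Lemma star_Xe : X * e = X.
Proof. by rewrite mulr_sumr; apply: eq_bigr => i _; exact: star_Xf. Qed.
Lemma star_eY : e * Y = Y.
Proof. by rewrite mulr_suml; apply: eq_bigr => i _; exact: star_fY. Qed.
(** The arrow [x i] ends at the boundary vertex [i], where [Y] contributes only [y i]; the cross
    terms vanish and [star_xy] applies. *)
Lemma star_XY : X * Y = f None.
Proof.
rewrite mulr_suml -(star_xy Bsys); apply: eq_bigr => i _.
by rewrite -(star_xf Bsys) -mulrA star_fY (star_xf Bsys).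
Qed.
Lemma star_ef i : e * f (Some i) = f (Some i).
Proof.
rewrite mulr_suml (bigD1 i) //= big1 ?addr0 ?(star_ff Bsys) // => j ji.
exact: (star_orth Bsys).
Qed.
Lemma star_fe i : f (Some i) * e = f (Some i).
Proof.
rewrite mulr_sumr (bigD1 i) //= big1 ?addr0 ?(star_ff Bsys) // => j ji.
by rewrite (star_orth Bsys) // eq_sym.
Qed.
Lemma star_ef0 : e * f None = 0.
Proof. by rewrite mulr_suml big1 // => i _; rewrite (star_orth Bsys). Qed.
Lemma star_f0e : f None * e = 0.
Proof. by rewrite mulr_sumr big1 // => i _; rewrite (star_orth Bsys). Qed.
Lemma star_Yf i : Y * f (Some i) = 0.
Proof. by rewrite -star_Yf0 -mulrA (star_orth Bsys) ?mulr0. Qed.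
Lemma star_fX i : f (Some i) * X = 0.
Proof. by rewrite -star_f0X mulrA (star_orth Bsys) ?mul0r. Qed.
Lemma star_ex i : e * x i = 0.
Proof. by rewrite -(star_fx Bsys) mulrA star_ef0 mul0r. Qed.
Lemma star_ye i : y i * e = 0.
Proof. by rewrite -(star_yf Bsys) -mulrA star_f0e mulr0. Qed.
Lemma star_xe i : x i * e = x i.
Proof. by rewrite -(star_xf Bsys) -mulrA star_fe. Qed.
Lemma star_ey i : e * y i = y i.
Proof. by rewrite -(star_fy Bsys) mulrA star_ef. Qed.
Lemma star_xX i : x i * X = 0.
Proof. by rewrite -(star_xf Bsys) -mulrA star_fX mulr0. Qed.
Lemma star_Yy i : Y * y i = 0.
Proof. by rewrite -(star_fy Bsys) mulrA star_Yf mul0r. Qed.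
Lemma star_ee : e * e = e.
Proof. by rewrite {2}/e mulr_sumr; apply: eq_bigr => i _; exact: star_ef. Qed.

(** Idempotence is [Y (X Y) X = Y f_0 X = Y X], and compressing [Y X] by [f_i] gives
    [y_i x_i = r_i f_i]. *)
Lemma star_A_system : A_system r e (Y * X) (fun i => f (Some i)).
Proof.
split=> [|||i|i j ij|i|//].
- by rewrite mulrA star_eY.
- by rewrite -mulrA star_Xe.
- by rewrite mulrA -(mulrA Y) star_XY star_Yf0.
- exact: (star_ff Bsys).
- exact: (star_orth Bsys).
by rewrite mulrA star_fY -mulrA star_Xf (star_yx Bsys).
Qed.

Variables (phi : corner_hom A B) (psi : corner_hom B (mx_alg A 2)).
Hypotheses (phi1 : phi 1 = e) (phip : phi p = Y * X)
  (phiq : forall i, phi (q i) = f (Some i)).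
Hypotheses (psif : forall v, psi (f v) =
    if v is Some i then elem_mx 0 0 (q i) else elem_mx 1 1 p)
  (psix : forall i, psi (x i) = elem_mx 1 0 (p * q i))
  (psiy : forall i, psi (y i) = elem_mx 0 1 (q i * p)).
Hypothesis A_ind : forall P : A -> Prop,
  P 1 -> P p -> (forall i, P (q i)) ->
  (forall x y, P x -> P y -> P (x + y)) ->
  (forall x y, P x -> P y -> P (x * y)) ->
  (forall c x, P x -> P (alg_scal _ c * x)) -> forall x, P x.
Hypothesis B_ind : forall P : B -> Prop,
  (forall v, P (f v)) -> (forall i, P (x i)) -> (forall i, P (y i)) ->
  (forall x y, P x -> P y -> P (x + y)) ->
  (forall x y, P x -> P y -> P (x * y)) ->
  (forall c x, P x -> P (alg_scal _ c * x)) -> forall x, P x.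

Let wB (j : 'I_2) (l : 'I_1) : B := if j == 0 then e else Y.
Let wB' (j : 'I_2) (l : 'I_1) : B := if j == 0 then e else X.
(** The first basis vector, serving both as column and as row: conjugating [a] by it gives
    [a E_00]. *)
Let wA (j : 'I_1) (l : 'I_2) : A := (l == 0)%:R.

Lemma wB_sum : \sum_j \sum_l wB' j l * wB j l = 1.
Proof.
rewrite big_ord_recl big_ord1 !big_ord1 /wB /wB' /= star_ee star_XY.
exact: star_e1.
Qed.

(** On each generator, the incidence relations leave one possibly nonzero entry of [w z w'], at the
    matrix unit used by [psi]: [e f_i e = f_i], [Y f_0 X = Y X], [Y x_i e = Y X f_i] and
    [e y_i X = f_i Y X]. *)
Lemma conjugation_star z : conjugation_at (corner_mx1 phi) psi wB wB' z.
Proof.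
elim/B_ind: z => [[i|]|i|i|a b|a b|c a].
- elim/forall_ord2; elim/forall_ord2=> l l';
    rewrite corner_mx1E psif elem_mxE /wB /wB' /= ?raddf0.
  + by rewrite phiq star_ef star_fe.
  + by rewrite star_ef star_fX.
  + by rewrite star_Yf mul0r.
  by rewrite star_Yf mul0r.
- elim/forall_ord2; elim/forall_ord2=> l l';
    rewrite corner_mx1E psif elem_mxE /wB /wB' /= ?raddf0.
  + by rewrite star_ef0 mul0r.
  + by rewrite star_ef0 mul0r.
  + by rewrite -mulrA star_f0e mulr0.
  by rewrite phip star_Yf0.
- elim/forall_ord2; elim/forall_ord2=> l l';
    rewrite corner_mx1E psix elem_mxE /wB /wB' /= ?raddf0.
  + by rewrite star_ex mul0r.
  + by rewrite star_ex mul0r.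
  + by rewrite corner_homM phip phiq -!mulrA star_Xf star_xe.
  by rewrite -mulrA star_xX mulr0.
- elim/forall_ord2; elim/forall_ord2=> l l';
    rewrite corner_mx1E psiy elem_mxE /wB /wB' /= ?raddf0.
  + by rewrite -mulrA star_ye mulr0.
  + by rewrite corner_homM phip phiq mulrA star_fY star_ey.
  + by rewrite star_Yy mul0r.
  by rewrite star_Yy mul0r.
- exact: conjugation_atD.
- exact: (conjugation_atM wB_sum).
exact: conjugation_atZ.
Qed.

Lemma psi_phi a : psi (phi a) = elem_mx 0 0 a.
Proof.
elim/A_ind: a => [||i|a b IHa IHb|a b IHa IHb|c a IHa].
- rewrite phi1 raddf_sum -(A_sum Asys) raddf_sum.
  by apply: eq_bigr => i _; exact: psif.
(* The image of [Y X] is the double sum of the [q_i p p q_j E_00], which collapses to [p E_00]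
   because [p] is idempotent and the [q_i] sum to [1]. *)
- rewrite phip corner_homM !raddf_sum mulr_sumr /=.
  rewrite (eq_bigr (fun j => elem_mx 0 0 (p * q j))) => [|j _].
    by rewrite -raddf_sum -mulr_sumr (A_sum Asys) mulr1.
  rewrite psix mulr_suml (eq_bigr (fun i => elem_mx 0 0 (q i * (p * q j)))).
    by rewrite -raddf_sum -mulr_suml (A_sum Asys) mul1r.
  move=> i _; rewrite psiy elem_mxM -[q i * p * _]mulrA [p * (p * _)]mulrA.
  by rewrite (A_pp Asys).
- by rewrite phiq psif.
- by rewrite !raddfD /= IHa IHb.
- by rewrite !corner_homM IHa IHb elem_mxM.
by rewrite !corner_homZ IHa elem_mxZ.
Qed.

Lemma conjugation_A a : conjugation_at psi (corner_mx1 phi) wA wA a.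
Proof.
move=> j j' l l'; rewrite corner_mx1E psi_phi elem_mxE /wA.
by do 2!case: (_ == 0); rewrite ?mul1r ?mulr1 ?mul0r ?mulr0.
Qed.

Lemma systems_morita : morita_equivalent A B.
Proof.
(* Each functor runs opposite to its morphism: [psi], defined on [B], carries [A]-modules to
   [B]-modules. *)
exists (corner_functor psi), (corner_functor (corner_mx1 phi)); split.
- apply: (corner_comp_iso (w := wA) (w' := wA)); last exact: conjugation_A.
  by rewrite big_ord1 big_ord_recl big_ord1 /wA /= mulr1 mulr0 addr0.
apply: (corner_comp_iso wB_sum); exact: conjugation_star.
Qed.

End Systems.

Theorem proposition3 (F : fieldType) (charF : [pchar F] =i pred0)
    (n k : nat) (r : 'I_n -> F) (r_neq0 : forall i, r i != 0)
    (sum_r : \sum_(i < n) r i = k%:R) :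
  morita_equivalent (A_alg r)
    (@deformed_preprojective F (star_quiver n) (star_weight r)).
Proof.
have Asys := A_alg_system r; have Bsys := deformed_star_system r.
(* Each algebra contains, up to [2 x 2] matrices, a system of the kind that presents the other, and
   the universal properties turn these systems into [phi] and [psi]. *)
have [phi [phi1 phip phiq]] := A_alg_lift (star_A_system Bsys).
have [psi [psif psix psiy]] := deformed_star_lift (elem_mx_star_system Asys).
exact: (systems_morita Asys Bsys (deformed_star_sum r) phi1 phip phiq
  psif psix psiy (A_alg_ind (r := r)) (deformed_star_ind (r := r))).
Qed.
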